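(* Let $N\ge3$, $n\ge1$, let $a_1,\dots,a_n\in\mathbb{R}^N$, and let $A$ be a positive definite real symmetric $N\times N$ matrix. Then for every $\varphi\in H^1_\mu$, $$\frac{c_o}{n}\int_{\mathbb{R}^N}\sum_{i=1}^n\frac{\varphi^2}{|x-a_i|^2}\,d\mu\le\int_{\mathbb{R}^N}|\nabla\varphi|^2\,d\mu+\frac n2\operatorname{Tr}A\int_{\mathbb{R}^N}\varphi^2\,d\mu,$$ where $c_o=\left(\frac{N-2}{2}\right)^2$.
   Context: $d\mu=\mu(x)\,dx$ with $\mu(x)=C\,e^{-\frac12\sum_{i=1}^n\langle A(x-a_i),x-a_i\rangle}$ and $C$ the normalizing constant making $\mu$ a probability density. $L^2_\mu=L^2(\mathbb{R}^N,d\mu)$. $H^1_\mu$ is the space of $f\in L^2_\mu$ with distributional gradient in $(L^2_\mu)^N$; equivalently the completion of $C_c^\infty(\mathbb{R}^N)$ in the norm $\|u\|_{H^1_\mu}^2=\|u\|^2_{L^2_\mu}+\|\nabla u\|^2_{L^2_\mu}$. *)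

(* Defs.v *)
From HB Require Import structures.
From mathcomp Require Import all_boot all_order all_algebra.
From mathcomp Require Import all_classical all_reals all_analysis.
Set Implicit Arguments. Unset Strict Implicit. Unset Printing Implicit Defensive.
Import Order.TTheory GRing.Theory Num.Theory.
Import numFieldNormedType.Exports.
Local Open Scope classical_set_scope.
Local Open Scope ring_scope.

Section Defs.
Variable R : realType.

(* Lebesgue integral over R^N of a nonnegative function, as the iterated
   integral dx_0 dx_1 ... dx_{N-1} (Tonelli) w.r.t. Lebesgue measure on R. *)
Fixpoint intRN (N : nat) : ('rV[R]_N -> \bar R) -> \bar R :=
  match N return ('rV[R]_N -> \bar R) -> \bar R with
  | 0 => fun f => f 0
  | N'.+1 => fun f =>
      (\int[@lebesgue_measure R]_(t in setT)
          intRN (fun y : 'rV[R]_N' => f (row_mx (const_mx t : 'rV[R]_1) y)))%E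
  end.

Definition sqnorm (N : nat) (v : 'rV[R]_N) : R := \sum_(i < N) (v ord0 i) ^+ 2.

Definition partial (N : nat) (i : 'I_N) (f : 'rV[R]_N -> R) : 'rV[R]_N -> R :=
  fun x => 'D_(delta_mx ord0 i) f x.

Definition grad (N : nat) (f : 'rV[R]_N -> R) (x : 'rV[R]_N) : 'rV[R]_N :=
  \row_(i < N) partial i f x.

Fixpoint Ck (N : nat) (k : nat) (f : 'rV[R]_N -> R) : Prop :=
  match k with
  | 0 => continuous f
  | k'.+1 => (forall x, differentiable f x) /\ (forall i : 'I_N, Ck k' (partial i f))
  end.

Definition smooth (N : nat) (f : 'rV[R]_N -> R) : Prop := forall k, Ck k f.

Definition compact_support (N : nat) (f : 'rV[R]_N -> R) : Prop :=
  exists r : R, forall x, r < sqnorm x -> f x = 0.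

Definition Cc_infty (N : nat) (f : 'rV[R]_N -> R) : Prop :=
  smooth f /\ compact_support f.

Definition borelRN (N : nat) : set (set 'rV[R]_N) :=
  <<s [set U | open U] >>.

Definition borel_fun (N : nat) (f : 'rV[R]_N -> R) : Prop :=
  forall B : set R, measurable B -> borelRN (f @^-1` B).

Definition qform (N : nat) (A : 'M[R]_N) (v : 'rV[R]_N) : R :=
  (v *m A *m v^T) ord0 ord0.

Definition pos_def_sym (N : nat) (A : 'M[R]_N) : Prop :=
  A^T = A /\ forall v : 'rV[R]_N, v != 0 -> 0 < qform A v.

Definition gauss_unnorm (N n : nat) (A : 'M[R]_N) (a : 'I_n -> 'rV[R]_N)
    (x : 'rV[R]_N) : R :=
  expR (- (1/2) * \sum_(i < n) qform A (x - a i)).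

Definition mu_dens (N n : nat) (A : 'M[R]_N) (a : 'I_n -> 'rV[R]_N)
    (x : 'rV[R]_N) : R :=
  gauss_unnorm A a x / fine (intRN (fun y => (gauss_unnorm A a y)%:E)).

(* phi in H^1_mu, with weak gradient g: phi is the limit in H^1_mu of a
   sequence of C_c^infty functions (completion definition). *)
Definition H1mu_with_grad (N n : nat) (A : 'M[R]_N) (a : 'I_n -> 'rV[R]_N)
    (phi : 'rV[R]_N -> R) (g : 'rV[R]_N -> 'rV[R]_N) : Prop :=
  borel_fun phi /\ (forall j : 'I_N, borel_fun (fun x => g x ord0 j)) /\
  exists u : nat -> 'rV[R]_N -> R,
    (forall k, Cc_infty (u k)) /\
    ((fun k => intRN (fun x => ((u k x - phi x) ^+ 2 * mu_dens A a x)%:E))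
       @ \oo --> 0%E) /\
    ((fun k => intRN (fun x => (sqnorm (grad (u k) x - g x) * mu_dens A a x)%:E))
       @ \oo --> 0%E).

End Defs.

(* Main.v *)
(** Let rho = exp (- U) be the Gaussian density, V = grad U and beta = (N-2)/2.
    For u smooth with compact support and any vector field W,
      0 <= |grad u + u W|^2 rho
         = |grad u|^2 rho - u^2 (div W - <W, V> - |W|^2) rho + div (u^2 W rho),
    and the last term integrates to 0.  Take W = beta X - V / 2 with
    X = (x - b) / (|x - b|^2 + e): the mixed terms cancel, div X >= 2 beta |X|^2
    and Delta U = n tr A, so that, up to a divergence,
      beta^2 u^2 |X|^2 rho <= |grad u|^2 rho + (n/2) tr A u^2 rho.
    Since |X|^2 is bounded, the integrated inequality passes to limits in H^1;
    then e -> 0 by Fatou's lemma, and averaging over the poles b = a_i gives the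
    factor 1/n.

    The iterated integral [intRN] is the integral against a sigma-finite measure
    on the Borel sets of R^N, obtained by pushing forward products along
    [row_mx]. *)

Require Import Defs.
From HB Require Import structures.
From mathcomp Require Import all_boot all_order all_algebra.
From mathcomp Require Import all_classical all_reals all_analysis.
From mathcomp Require Import measurable_realfun ring lra.
Import Order.TTheory GRing.Theory Num.Theory.
Import numFieldNormedType.Exports.
Local Open Scope classical_set_scope.
Local Open Scope ring_scope.
Set Implicit Arguments.
Unset Strict Implicit.
Unset Printing Implicit Defensive.

(** * Lebesgue measure on R^N *)

HB.instance Definition _ (R : realType) (N : nat) :=
  Measurable.copy 'rV[R]_N
    (g_sigma_algebraType [set U : set 'rV[R]_N | open U]).

Section BorelRowVector.
Variable R : realType.

Lemma open_measurable_rV N (U : set 'rV[R]_N) : open U -> measurable U.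
Proof. by move=> oU; exact: sub_gen_smallest. Qed.

Lemma compact_measurable_rV N (K : set 'rV[R]_N) : compact K -> measurable K.
Proof.
move=> cK; rewrite -[K]setCK; apply: measurableC; apply: open_measurable_rV.
by apply: closed_openC; apply: compact_closed cK; exact: norm_hausdorff.
Qed.

Lemma measurable_fun_rV d (T : measurableType d) N (F : T -> 'rV[R]_N) :
  (forall U, open U -> measurable (F @^-1` U)) -> measurable_fun setT F.
Proof.
move=> FU; apply: (measurability [set U : set 'rV[R]_N | open U] erefl).
by move=> _ [U /= oU <-]; rewrite setTI; exact: FU.
Qed.

Lemma continuous_measurable_rV N (f : 'rV[R]_N -> R) :
  continuous f -> measurable_fun setT f.
Proof.
move=> /continuousP cf; apply: (measurability _ (RGenOpens.measurableE R)).
move=> _ [_ [a [b ->]] <-]; rewrite setTI; apply: open_measurable_rV.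
by apply: cf; exact: interval_open.
Qed.

Lemma borel_fun_measurable N (f : 'rV[R]_N -> R) :
  borel_fun f -> measurable_fun setT f.
Proof. by move=> bf _ B mB; rewrite setTI; exact: bf. Qed.

Definition rat_ball N (i : 'rV[rat]_N * nat) : set 'rV[R]_N :=
  ball (map_mx (@ratr R) i.1 : 'rV[R]_N) (i.2.+1%:R^-1 : R).

Lemma rat_ball_center N (x : 'rV[R]_N) (k : nat) :
  exists q : 'rV[rat]_N, rat_ball (q, k) x.
Proof.
have k0 : 0 < k.+1%:R^-1 :> R by [].
have qx j : exists q : rat, ball (ratr q : R) k.+1%:R^-1 (x ord0 j).
  have [y [xy [q _ qy]]] :
      ball (x ord0 j) k.+1%:R^-1 `&` range (@ratr R) !=set0.
    apply: dense_rat; last exact: ball_open.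
    by exists (x ord0 j); exact: ballxx.
  by exists q; rewrite qy; exact: ball_sym.
exists (\row_j xchoose (qx j)); split=> // i j; rewrite !mxE (ord1 i).
exact: xchooseP (qx j).
Qed.

Lemma open_bigcup_rat_ball N (U : set 'rV[R]_N) : open U ->
  U = \bigcup_(i in [set i | rat_ball i `<=` U]) rat_ball i.
Proof.
move=> oU; apply/seteqP; split=> [x Ux|x [i iU]]; last exact: iU.
have /nbhs_ballP[e /= e0 eU] : nbhs x U by exact: open_nbhs_nbhs.
have [k ke] : exists k : nat, k.+1%:R^-1 < e / 2.
  have e20 : 0 < e / 2 by rewrite divr_gt0.
  have [k _ /(_ k (leqnn k)) ke] := near_infty_natSinv_lt (PosNum e20).
  by exists k.
have [q qx] := rat_ball_center x k; exists (q, k) => //= y qy; apply: eU.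
apply: (@ball_splitr _ _ (map_mx (@ratr R) q)).
- exact: (le_ball (ltW ke)) qx.
- exact: (le_ball (ltW ke)) qy.
Qed.

End BorelRowVector.

Section ConsRowVector.
Variables (R : realType) (N : nat).
Implicit Types (z : R * 'rV[R]_N) (x : 'rV[R]_N.+1) (i j : 'I_N).

Definition cons_rV z : 'rV[R]_N.+1 := row_mx (const_mx z.1 : 'rV[R]_1) z.2.

Definition uncons_rV x : R * 'rV[R]_N := (x ord0 ord0, col' ord0 x).

Lemma cons_rV0 z : cons_rV z ord0 ord0 = z.1.
Proof.
rewrite /cons_rV; have -> : ord0 = lshift N (ord0 : 'I_1) by exact: val_inj.
by apply: (etrans (row_mxEl _ _ _ _)); rewrite mxE.
Qed.

Lemma cons_rVS z j : cons_rV z ord0 (lift ord0 j) = z.2 ord0 j.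
Proof.
rewrite /cons_rV; have -> : lift ord0 j = rshift 1 j by exact: val_inj.
exact: row_mxEr.
Qed.

Lemma eq_cons_rV z x : x ord0 ord0 = z.1 ->
  (forall j, x ord0 (lift ord0 j) = z.2 ord0 j) -> x = cons_rV z.
Proof.
move=> x0 xS; apply/rowP => k.
by case: (unliftP ord0 k) => [j|] ->; rewrite ?cons_rVS ?cons_rV0.
Qed.

Lemma cons_rVK : cancel cons_rV uncons_rV.
Proof.
move=> [t y]; rewrite /uncons_rV cons_rV0; congr pair; apply/rowP => j.
by rewrite mxE cons_rVS.
Qed.

Lemma uncons_rVK : cancel uncons_rV cons_rV.
Proof. by move=> x; apply/esym/eq_cons_rV => // j; rewrite mxE. Qed.

Lemma ball_cons_rV z (e : R) :
  cons_rV @^-1` ball (cons_rV z) e = ball z.1 e `*` ball z.2 e.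
Proof.
apply/seteqP; split=> [[t y] /= [e0 zty]|[t y] /= [zt [e0 zy]]].
  split=> /=; first by have := zty ord0 ord0; rewrite !cons_rV0.
  by split=> // i j; have := zty ord0 (lift ord0 j); rewrite !cons_rVS (ord1 i).
split=> // i k; rewrite (ord1 i); case: (unliftP ord0 k) => [j|] ->.
  by rewrite !cons_rVS; exact: zy.
by rewrite !cons_rV0.
Qed.

Lemma continuous_cons_rV : continuous cons_rV.
Proof.
move=> z U /nbhs_ballP[e /= e0 eU]; apply/nbhs_ballP; exists e => //= z' zz'.
by apply: eU; have := ball_cons_rV z e => /seteqP[_]; exact.
Qed.

Lemma measurable_cons_rV : measurable_fun setT cons_rV.
Proof.
apply: measurable_fun_rV => U oU; rewrite (open_bigcup_rat_ball oU).
rewrite preimage_bigcup bigcup_mkcond.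
apply: countable_bigcupT_measurable => // i.
case: ifPn => // _; rewrite /rat_ball -[map_mx _ _]uncons_rVK ball_cons_rV.
apply: measurableX; first exact: measurable_ball.
by apply: open_measurable_rV; exact: ball_open.
Qed.

Lemma measurable_uncons_rV : measurable_fun setT uncons_rV.
Proof.
apply/measurable_fun_pair.
  by apply: continuous_measurable_rV; exact: coord_continuous.
apply: measurable_fun_rV => U oU; apply: open_measurable_rV.
move: U oU; apply/continuousP => x U /nbhs_ballP[e /= e0 eU].
apply/nbhs_ballP; exists e => //= y [_ xy]; apply: eU; split=> // i j.
by rewrite !mxE; exact: xy.
Qed.

End ConsRowVector.

Lemma sigma_finite_pushforward d1 d2 (T1 : measurableType d1)
    (T2 : measurableType d2) (R : realType) (m : set T1 -> \bar R)
    (f : T1 -> T2) (g : T2 -> T1) :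
  measurable_fun setT g -> cancel f g ->
  sigma_finite setT m -> sigma_finite setT (pushforward m f).
Proof.
move=> mg fK [F TF mF]; exists (fun k => g @^-1` F k).
  by rewrite -preimage_bigcup -TF preimage_setT.
move=> k; have [mFk Fk] := mF k; split.
  by rewrite -[X in measurable X]setTI; exact: mg.
by rewrite /pushforward -comp_preimage (_ : g \o f = id)//; apply/funext/fK.
Qed.

Lemma sigma_finite_product_measure d1 d2 (T1 : measurableType d1)
    (T2 : measurableType d2) (R : realType)
    (m1 : {sigma_finite_measure set T1 -> \bar R})
    (m2 : {sigma_finite_measure set T2 -> \bar R}) :
  sigma_finite setT (m1 \x m2)%E.
Proof.
have /sigma_finiteP[F [FT Fnd Foo]] := sigma_finiteT m1.
have /sigma_finiteP[G [GT Gnd Goo]] := sigma_finiteT m2.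
exists (fun k => F k `*` G k) => [|k].
  apply/seteqP; split=> // -[x y] _.
  have [i _ Fx] : (\bigcup_k F k) x by rewrite -FT.
  have [j _ Gy] : (\bigcup_k G k) y by rewrite -GT.
  exists (i + j)%N => //; split=> /=.
    by move: x Fx; apply/subsetPset/Fnd; exact: leq_addr.
  by move: y Gy; apply/subsetPset/Gnd; exact: leq_addl.
have [mF Fk] := Foo k; have [mG Gk] := Goo k; split; first exact: measurableX.
by rewrite product_measure1E// lte_mul_pinfty// ge0_fin_numE.
Qed.

Section ConsMeasure.
Variables (R : realType) (N : nat).
Variable nu : {sigma_finite_measure set 'rV[R]_N -> \bar R}.

Definition cons_measure : set 'rV[R]_N.+1 -> \bar R :=
  pushforward (@lebesgue_measure R \x nu)%E (@cons_rV R N).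

(* Unification does not find the measurability proof on which the measure
   instance of [pushforward] depends. *)
HB.instance Definition _ := Measure.copy cons_measure
  (measure_function_pushforward__canonical__measure_function_Measure
     (@lebesgue_measure R \x nu)%E (@measurable_cons_rV R N)).

HB.instance Definition _ := Measure_isSigmaFinite.Build _ _ _ cons_measure
  (sigma_finite_pushforward (@measurable_uncons_rV R N) (@cons_rVK R N)
     (sigma_finite_product_measure (@lebesgue_measure R) nu)).

Implicit Types f : 'rV[R]_N.+1 -> \bar R.

Lemma ge0_integral_cons_measure f :
  measurable_fun setT f -> (forall x, 0 <= f x)%E ->
  (\int[cons_measure]_x f x =
   \int[@lebesgue_measure R]_t \int[nu]_y f (cons_rV (t, y)))%E.
Proof.
move=> mf f0; rewrite ge0_integral_pushforward//;
  last exact: measurable_cons_rV.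
rewrite preimage_setT fubini_tonelli1//; last by move=> z; exact: f0.
by apply: measurableT_comp => //; exact: measurable_cons_rV.
Qed.

Lemma integrable_comp_cons_rV f : cons_measure.-integrable setT f ->
  (@lebesgue_measure R \x nu)%E.-integrable setT (f \o @cons_rV R N).
Proof.
move=> /integrableP[mf foo]; apply/integrableP; split.
  by apply: measurableT_comp => //; exact: measurable_cons_rV.
move: foo; rewrite ge0_integral_pushforward//; first exact: measurable_cons_rV.
exact: measurableT_comp.
Qed.

Lemma integral12_cons_measure f : cons_measure.-integrable setT f ->
  (\int[cons_measure]_x f x =
   \int[@lebesgue_measure R]_t \int[nu]_y f (cons_rV (t, y)))%E.
Proof.
move=> fi; have /integrableP[mf _] := fi.
have ci := integrable_comp_cons_rV fi.
rewrite integral_pushforward//; last exact: measurable_cons_rV.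
by rewrite preimage_setT -integral12_prod_meas1.
Qed.

Lemma integral21_cons_measure f : cons_measure.-integrable setT f ->
  (\int[cons_measure]_x f x =
   \int[nu]_y \int[@lebesgue_measure R]_t f (cons_rV (t, y)))%E.
Proof.
move=> fi; have /integrableP[mf _] := fi.
have ci := integrable_comp_cons_rV fi.
rewrite integral_pushforward//; last exact: measurable_cons_rV.
by rewrite preimage_setT -integral21_prod_meas1.
Qed.

End ConsMeasure.

Fixpoint lebesgue_rV (R : realType) (N : nat) :
    {sigma_finite_measure set 'rV[R]_N -> \bar R} :=
  match N with
  | 0 => dirac (0 : 'rV[R]_0)
  | N'.+1 => cons_measure (lebesgue_rV R N')
  end.

Section LebesgueRowVector.
Variable R : realType.

Lemma intRN_lebesgue N (f : 'rV[R]_N -> \bar R) :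
  measurable_fun setT f -> (forall x, 0 <= f x)%E ->
  intRN f = (\int[lebesgue_rV R N]_x f x)%E.
Proof.
elim: N f => [|N IH] f mf f0 /=.
  by rewrite integral_dirac// diracT mul1e.
rewrite ge0_integral_cons_measure//; apply: eq_integral => t _.
apply: IH => [|y]; last exact: f0.
apply: (measurableT_comp mf).
exact: measurableT_comp (@measurable_cons_rV R N) (pair1_measurable t).
Qed.

Lemma intRN_ge0 N (f : 'rV[R]_N -> \bar R) :
  (forall x, 0 <= f x)%E -> (0 <= intRN f)%E.
Proof.
elim: N f => [|N IH] f f0 /=; first exact: f0.
by apply: integral_ge0 => t _; apply: IH => y; exact: f0.
Qed.

Definition box N (M : R) : set 'rV[R]_N :=
  [set v | forall j, `[- M, M]%classic (v ord0 j)].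

Lemma compact_box N (M : R) : compact (@box N M).
Proof.
apply: (@rV_compact _ N (fun=> `[- M, M]%classic)) => j.
exact: segment_compact.
Qed.

Lemma cons_rV_box N (M : R) :
  @cons_rV R N @^-1` (@box N.+1 M) = `[- M, M]%classic `*` @box N M.
Proof.
apply/seteqP; split=> [[t y] tyM|[t y] [/= tM yM] j].
  split=> /=; first by have := tyM ord0; rewrite cons_rV0.
  by move=> j; have := tyM (lift ord0 j); rewrite cons_rVS.
case: (unliftP ord0 j) => [j'|] ->; first by rewrite cons_rVS; exact: yM.
by rewrite cons_rV0.
Qed.

Lemma lebesgue_rV_box_lty N (M : R) : (lebesgue_rV R N (box M) < +oo)%E.
Proof.
elim: N => [|N IH]; first by rewrite /= diracE ltry.
rewrite /= /cons_measure /pushforward cons_rV_box.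
rewrite product_measure1E//; last first.
  by apply: compact_measurable_rV; exact: compact_box.
apply: lte_mul_pinfty => //=.
by rewrite lebesgue_measure_itv; case: ifP; rewrite ?ltry.
Qed.

End LebesgueRowVector.

(** * Integration by parts *)

Section C1Along.
Variable R : realType.

Lemma continuous_funD (T : topologicalType) (f g : T -> R) :
  continuous f -> continuous g -> continuous (fun x => f x + g x).
Proof. by move=> cf cg x; exact: cvgD (cf x) (cg x). Qed.

Lemma continuous_funM (T : topologicalType) (f g : T -> R) :
  continuous f -> continuous g -> continuous (fun x => f x * g x).
Proof. by move=> cf cg x; exact: cvgM (cf x) (cg x). Qed.

Lemma continuous_fun_sum (T : topologicalType) (I : Type) (r : seq I)
    (F : I -> T -> R) :
  (forall i, continuous (F i)) -> continuous (fun x => \sum_(i <- r) F i x).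
Proof. by move=> cF; apply: continuous_big => //; exact: add_continuous. Qed.

Definition C1_along (V : normedModType R) (v : V) (f df : V -> R) :=
  [/\ continuous f, continuous df & forall x, is_derive x v f (df x)].

Lemma is_derive_line (V W : normedModType R) (f : V -> R) (g : W -> R)
    x v y w d :
  (forall k, g (k *: w + y) = f (k *: v + x)) ->
  is_derive x v f d -> is_derive y w g d.
Proof.
move=> gf [fx fxE].
have quotientE : (fun k => k^-1 *: ((g \o shift y) (k *: w) - g y)) =
                 (fun k => k^-1 *: ((f \o shift x) (k *: v) - f x)).
  apply/funext => k /=; rewrite gf.
  by have := gf 0; rewrite !scale0r !add0r => ->.
by split; rewrite /derivable /derive quotientE.
Qed.

Section Rules.
Variables (V : normedModType R) (v : V).
Implicit Types f g df dg : V -> R.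

Lemma eq_C1_along f g df dg : f =1 g -> df =1 dg ->
  C1_along v f df -> C1_along v g dg.
Proof. by move=> /funext <- /funext <-. Qed.

Lemma C1_along_cst (c : R) : C1_along v (fun=> c) (fun=> 0).
Proof.
by split=> x; [exact: cvg_cst|exact: cvg_cst|exact: is_derive_cst].
Qed.

Lemma C1_alongD f g df dg : C1_along v f df -> C1_along v g dg ->
  C1_along v (fun x => f x + g x) (fun x => df x + dg x).
Proof.
move=> [cf cdf fdf] [cg cdg gdg]; split=> [||x].
- exact: continuous_funD.
- exact: continuous_funD.
- exact: is_deriveD (fdf x) (gdg x).
Qed.

Lemma C1_alongM f g df dg : C1_along v f df -> C1_along v g dg ->
  C1_along v (fun x => f x * g x) (fun x => df x * g x + f x * dg x).
Proof.
move=> [cf cdf fdf] [cg cdg gdg]; split=> [||x].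
- exact: continuous_funM.
- by apply: continuous_funD; exact: continuous_funM.
- have /is_derive_eq := is_deriveM (fdf x) (gdg x); apply.
  by rewrite addrC [_ *: df x]mulrC.
Qed.

Lemma C1_along_scale (c : R) f df : C1_along v f df ->
  C1_along v (fun x => c * f x) (fun x => c * df x).
Proof.
move=> /(C1_alongM (C1_along_cst c)); apply: eq_C1_along => x //.
by rewrite mul0r add0r.
Qed.

Lemma C1_along_sum (I : Type) (r : seq I) (F dF : I -> V -> R) :
  (forall i, C1_along v (F i) (dF i)) ->
  C1_along v (fun x => \sum_(i <- r) F i x) (fun x => \sum_(i <- r) dF i x).
Proof.
move=> FdF; elim: r => [|i r IH].
  by apply: eq_C1_along (C1_along_cst 0) => x; rewrite big_nil.
by apply: eq_C1_along (C1_alongD (FdF i) IH) => x; rewrite big_cons.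
Qed.

Lemma C1_alongV f df : (forall x, f x != 0) -> C1_along v f df ->
  C1_along v (fun x => (f x)^-1) (fun x => - (f x) ^- 2 * df x).
Proof.
move=> f0 [cf cdf fdf]; split=> x.
- exact: cvgV (f0 x) (cf x).
- apply: cvgM (cdf x); apply: cvgN; apply: cvgV; first by rewrite expf_neq0.
  exact: cvgM (cf x) (cf x).
- have [fx fxE] := fdf x; split; first exact: derivableV.
  by rewrite deriveV// fxE.
Qed.

Lemma C1_along_eq0 (p : V -> R) f df (r : R) :
  continuous p -> C1_along v f df -> (forall x, r < p x -> f x = 0) ->
  forall x, r < p x -> df x = 0.
Proof.
move=> cp [_ _ fdf] f0 x rx; have [_ <-] := fdf x.
rewrite (@near_eq_derive _ _ _ f (cst 0)) ?derive_cst//.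
have rp : \forall y \near x, r < p y by apply: (cvgr_gt (p x)) => //; exact: cp.
by apply: filterS rp => y /f0 ->.
Qed.

Lemma C1_along_expR f df : C1_along v f df ->
  C1_along v (fun x => expR (f x)) (fun x => df x * expR (f x)).
Proof.
move=> [cf cdf fdf]; have cexpf : continuous (expR \o f).
  by move=> x; exact: continuous_comp (cf x) (@continuous_expR _ _).
split=> [//|x|x]; first exact: cvgM (cdf x) (cexpf x).
have fline : is_derive (0 : R) (1 : R) (fun k => f (k *: v + x)) (df x).
  by apply: is_derive_line (fdf x) => k; rewrite addr0 [k *: 1]mulr1.
have := is_derive1_comp (is_derive_expR _) fline.
rewrite scale0r add0r mulrC; apply: is_derive_line => k /=.
by rewrite addr0 [k *: 1]mulr1.
Qed.

End Rules.

Lemma C1_along_comp_line (V W : normedModType R) (v : V) (w : W) (p : W -> V)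
    f df :
  continuous p -> (forall k y, p (k *: w + y) = k *: v + p y) ->
  C1_along v f df -> C1_along w (f \o p) (df \o p).
Proof.
move=> cp pline [cf cdf fdf]; split=> y.
- exact: continuous_comp (cp y) (cf (p y)).
- exact: continuous_comp (cp y) (cdf (p y)).
- by apply: is_derive_line (fdf (p y)) => k /=; rewrite pline.
Qed.

Lemma C1_along_id (c : R) : C1_along c id (fun=> c).
Proof. by split=> x; [exact: cvg_id|exact: cvg_cst|exact: is_derive_id]. Qed.

Section RowVector.
Variable N : nat.
Implicit Types b v : 'rV[R]_N.

Lemma sum_delta_rV (i : 'I_N) (c : 'I_N -> R) :
  \sum_j (delta_mx ord0 i : 'rV[R]_N) ord0 j * c j = c i.
Proof.
rewrite (bigD1 i)//= mxE !eqxx mul1r big1 ?addr0// => j ji.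
by rewrite mxE eqxx (negbTE ji) mul0r.
Qed.

Lemma C1_along_coordB b v j :
  C1_along v (fun x => (x - b) ord0 j) (fun=> v ord0 j).
Proof.
apply: (C1_along_comp_line (p := fun x => (x - b) ord0 j)) (C1_along_id _).
  move=> x; exact: (continuous_comp (f := fun y : 'rV[R]_N => y - b)
    (cvgB cvg_id (cvg_cst _)) (@coord_continuous _ _ _ _ _ _)).
by move=> k x; rewrite -addrA mxE [X in X + _]mxE.
Qed.

Lemma C1_along_mulmxB (B : 'M[R]_N) b v j :
  C1_along v (fun x => ((x - b) *m B) ord0 j) (fun=> (v *m B) ord0 j).
Proof.
apply: eq_C1_along (C1_along_sum _ (fun k =>
  C1_along_scale (B k j) (C1_along_coordB b v k))) => x;
by rewrite mxE; apply: eq_bigr => k _; rewrite mulrC.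
Qed.

Lemma C1_along_sqnormB b v : C1_along v (fun x => sqnorm (x - b))
  (fun x => 2 * \sum_j v ord0 j * (x - b) ord0 j).
Proof.
apply: eq_C1_along (C1_along_sum _ (fun j =>
  C1_alongM (C1_along_coordB b v j) (C1_along_coordB b v j))) => x //.
by rewrite mulr_sumr; apply: eq_bigr => j _; ring.
Qed.

Lemma C1_along_qformB (B : 'M[R]_N) b v : B^T = B ->
  C1_along v (fun x => qform B (x - b))
    (fun x => 2 * \sum_j v ord0 j * ((x - b) *m B) ord0 j).
Proof.
move=> Bsym; apply: eq_C1_along (C1_along_sum _ (fun j =>
  C1_alongM (C1_along_mulmxB B b v j) (C1_along_coordB b v j))) => x.
  by rewrite /qform mxE; apply: eq_bigr => j _; rewrite [_^T _ _]mxE.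
have selfadj (y z : 'rV[R]_N) : \sum_j (y *m B) ord0 j * z ord0 j =
    \sum_j y ord0 j * (z *m B) ord0 j.
  pose pair (s t : 'rV[R]_N) := (s *m t^T) ord0 ord0.
  have pairE s t : pair s t = \sum_j s ord0 j * t ord0 j.
    by rewrite /pair mxE; apply: eq_bigr => j _; rewrite mxE.
  by rewrite -!pairE /pair trmx_mul Bsym mulmxA.
rewrite big_split/= (selfadj v) mulr_natl mulr2n; congr (_ + _).
by apply: eq_bigr => j _; rewrite mulrC.
Qed.

Lemma Ck1_continuous (u : 'rV[R]_N -> R) : Ck 1 u -> continuous u.
Proof. by move=> [du _] x; exact: differentiable_continuous. Qed.

Lemma C1_along_partial (u : 'rV[R]_N -> R) i :
  Ck 1 u -> C1_along (delta_mx ord0 i) u (partial i u).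
Proof.
move=> u_C1; split=> [||x]; [exact: Ck1_continuous|exact: u_C1.2|].
by apply: derivableP; apply: diff_derivable; exact: u_C1.1.
Qed.

(* The divergence of F is then [\sum_i dF i]. *)
Definition C1_field (F dF : 'I_N -> 'rV[R]_N -> R) :=
  forall i, C1_along (delta_mx ord0 i : 'rV[R]_N) (F i) (dF i).

End RowVector.

End C1Along.

Lemma ltr_sqr_of_normrD1 (R : realDomainType) (r t : R) :
  `|r| + 1 < `|t| -> r < t ^+ 2.
Proof.
move=> rt; rewrite -[t ^+ 2]real_normK ?num_real//.
by have := ler_norm r; have := normr_ge0 r; nra.
Qed.

Section CompactSupport.
Variables (R : realType) (N : nat).
Implicit Types f g : 'rV[R]_N -> R.

Lemma sqnorm_ge0 (v : 'rV[R]_N) : 0 <= sqnorm v.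
Proof. by apply: sumr_ge0 => i _; rewrite sqr_ge0. Qed.

Lemma continuous_sqnorm : continuous (@sqnorm R N).
Proof.
have [+ _ _] := C1_along_sqnormB (0 : 'rV[R]_N) 0.
by rewrite (_ : (fun x => _) = @sqnorm R N)//; apply/funext => x; rewrite subr0.
Qed.

Lemma compact_support_C1_along v f df :
  C1_along v f df -> compact_support f -> compact_support df.
Proof.
move=> fdf [r f0]; exists r; exact: C1_along_eq0 continuous_sqnorm fdf f0.
Qed.

Lemma compact_supportW f g : (forall x, f x = 0 -> g x = 0) ->
  compact_support f -> compact_support g.
Proof. by move=> fg [r f0]; exists r => x /f0/fg. Qed.

Lemma compact_supportD f g : compact_support f -> compact_support g ->
  compact_support (fun x => f x + g x).
Proof.
move=> [r f0] [s g0]; exists (Num.max r s) => x.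
by rewrite gt_max => /andP[rx sx]; rewrite f0// g0// addr0.
Qed.

Lemma compact_support_sum (I : Type) (r : seq I) (F : I -> 'rV[R]_N -> R) :
  (forall i, compact_support (F i)) ->
  compact_support (fun x => \sum_(i <- r) F i x).
Proof.
move=> F0; elim: r => [|i r [s IH]]; first by exists 0 => x _; rewrite big_nil.
have [t F_t] := compact_supportD (F0 i) (ex_intro _ s IH).
by exists t => x tx; rewrite big_cons; exact: F_t.
Qed.

Lemma compact_support_box f : compact_support f ->
  exists M : R, forall x, ~ box M x -> f x = 0.
Proof.
move=> [r f0]; exists (`|r| + 1) => x /existsNP[j /negP].
rewrite in_itv/= -ler_norml -ltNge => /ltr_sqr_of_normrD1 rx; apply: f0.
apply: lt_le_trans rx _; rewrite /sqnorm (bigD1 j)//= lerDl.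
by apply: sumr_ge0 => i _; exact: sqr_ge0.
Qed.

Lemma integrable_continuous_compact_support f :
  continuous f -> compact_support f ->
  (lebesgue_rV R N).-integrable setT (EFin \o f).
Proof.
move=> cf /compact_support_box[M f0].
have mbox : measurable (@box R N M).
  by apply: compact_measurable_rV; exact: compact_box.
have -> : EFin \o f = (EFin \o f) \_ (box M).
  apply/funext => x; rewrite patchE; case: ifPn => // /negP Mx /=.
  by rewrite f0// => /mem_set.
apply/(integrable_mkcond (EFin \o f) mbox).1.
apply: measurable_bounded_integrable => //.
- exact: lebesgue_rV_box_lty.
- by apply: measurable_funTS; exact: continuous_measurable_rV.
- have [B [B_real fB]] := compact_bounded (continuous_compact
    (continuous_subspaceT cf) (@compact_box R N M)).
  by exists B; split=> // C BC x Mx; apply: (fB C BC); exists x.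
Qed.

End CompactSupport.

Section Divergence.
Variable R : realType.

Lemma integral_derive_eq0 (f df : R -> R) (M : R) :
  C1_along (1 : R) f df -> (forall t, M < `|t| -> f t = 0) ->
  (\int[@lebesgue_measure R]_t (df t)%:E = 0)%E.
Proof.
move=> fdf f0; have [cf cdf dfE] := fdf; pose K : R := `|M| + 1.
have K0 : 0 < K by rewrite ltr_wpDl.
have MK : M < K by rewrite (le_lt_trans (ler_norm _))// ltrDl.
have df0 := C1_along_eq0 (@norm_continuous _ R) fdf f0.
transitivity (\int[@lebesgue_measure R]_(t in `[(- K)%R, K]) (df t)%:E)%E.
  rewrite [RHS]integral_mkcond; apply: eq_integral => t _.
  rewrite patchE; case: ifPn => //; rewrite notin_setE/= in_itv/= -ler_norml.
  by move=> /negP; rewrite -ltNge => Kt; rewrite df0// (lt_trans MK).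
rewrite (@continuous_FTC2 _ df f).
- by rewrite !f0 ?subee// ?normrN gtr0_norm.
- by rewrite -subr_gt0 opprK addr_gt0.
- exact: continuous_subspaceT.
- split.
  + by move=> t _; have [] := dfE t.
  + by apply: cvg_at_right_filter; exact: cf.
  + by apply: cvg_at_left_filter; exact: cf.
- by move=> t _; rewrite derive1E; have [_ ->] := dfE t.
Qed.

Lemma sqnorm_cons_rV N (z : R * 'rV[R]_N) :
  sqnorm (cons_rV z) = z.1 ^+ 2 + sqnorm z.2.
Proof.
rewrite /sqnorm big_ord_recl cons_rV0; congr (_ + _).
by apply: eq_bigr => j _; rewrite cons_rVS.
Qed.

Lemma cons_rV_shift_head N k t (y : 'rV[R]_N) :
  cons_rV (k *: 1 + t, y) = k *: delta_mx ord0 ord0 + cons_rV (t, y).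
Proof.
apply/esym/eq_cons_rV => [|j]; rewrite mxE [X in X + _]mxE [X in _ * X]mxE.
  by rewrite cons_rV0 !eqxx.
by rewrite cons_rVS mulr0 add0r.
Qed.

Lemma cons_rV_shift_tail N k t (y : 'rV[R]_N) i :
  cons_rV (t, k *: delta_mx ord0 i + y) =
  k *: delta_mx ord0 (lift ord0 i) + cons_rV (t, y).
Proof.
apply/esym/eq_cons_rV => [|j]; rewrite mxE [X in X + _]mxE [X in _ * X]mxE.
  by rewrite cons_rV0 mulr0 add0r.
by rewrite cons_rVS !mxE (inj_eq lift_inj).
Qed.

Lemma integral_partial_eq0 N (i : 'I_N) (f df : 'rV[R]_N -> R) :
  C1_along (delta_mx ord0 i) f df -> compact_support f ->
  (\int[lebesgue_rV R N]_x (df x)%:E = 0)%E.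
Proof.
elim: N i f df => [[]//|N IH] i f df fdf f_cs; have [r f0] := f_cs.
have /integrable_continuous_compact_support : continuous df by have [] := fdf.
move=> /(_ (compact_support_C1_along fdf f_cs)) dfi.
have ccons := @continuous_cons_rV R N.
case: (unliftP ord0 i) => [j|] iE; rewrite iE in fdf.
- rewrite integral12_cons_measure//; apply: integral0_eq => t _ /=.
  apply: (IH j (fun y => f (cons_rV (t, y)))).
    apply: C1_along_comp_line fdf => [y|k y]; last exact: cons_rV_shift_tail.
    exact: (continuous_comp (cvg_pair (cvg_cst t) cvg_id) (ccons (t, y))).
  exists r => y ry; apply: f0; rewrite sqnorm_cons_rV.
  by rewrite (lt_le_trans ry)// lerDr sqr_ge0.
- rewrite integral21_cons_measure//; apply: integral0_eq => y _ /=.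
  apply: (@integral_derive_eq0 (fun t => f (cons_rV (t, y))) _ (`|r| + 1)).
    apply: C1_along_comp_line fdf => [t|k t]; last exact: cons_rV_shift_head.
    exact: (continuous_comp (cvg_pair cvg_id (cvg_cst y)) (ccons (t, y))).
  move=> t /ltr_sqr_of_normrD1 rt; apply: f0; rewrite sqnorm_cons_rV.
  by rewrite (lt_le_trans rt)// lerDl sqnorm_ge0.
Qed.

End Divergence.

(** * Weighted L^2 norms *)

Lemma peter_paul (R : realFieldType) (t x y : R) : 0 < t ->
  x ^+ 2 <= (1 + t) * y ^+ 2 + (1 + t^-1) * (y - x) ^+ 2.
Proof.
move=> t0; rewrite -subr_ge0.
have -> : (1 + t) * y ^+ 2 + (1 + t^-1) * (y - x) ^+ 2 - x ^+ 2 =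
  t^-1 * (t * y + (y - x)) ^+ 2.
  by field; rewrite gt_eqF.
by rewrite mulr_ge0 ?sqr_ge0// invr_ge0 ltW.
Qed.

Lemma peter_paul_dist_le (R : realFieldType) (x y d t : R) :
  0 < t -> 0 <= x -> 0 <= d ->
  (forall s, 0 < s -> x <= (1 + s) * y + (1 + s^-1) * d) ->
  (forall s, 0 < s -> y <= (1 + s) * x + (1 + s^-1) * d) ->
  `|x - y| <= 2 * t * x + (2 * t + 1 + t^-1) * d.
Proof.
move=> t0 x0 d0 xy yx; have /ltW ti0 : 0 < t^-1 by rewrite invr_gt0.
have td0 : 0 <= t * d by rewrite mulr_ge0// ltW.
have tx0 : 0 <= t * x by rewrite mulr_ge0// ltW.
have y_le : y <= 2 * x + 2 * d by have := yx 1 ltr01; rewrite invr1; lra.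
have ty_le : t * y <= t * (2 * x + 2 * d) by rewrite ler_pM2l.
rewrite ler_norml; have := xy t t0; have := yx t t0; lra.
Qed.

(* Convergence of norms in a form that avoids square roots: x, y_k and d_k stand
   for the squared norms of u, u_k and u_k - u. *)
Lemma peter_paul_cvgr (R : realType) (x : R) (y d : nat -> R) :
  0 <= x -> (forall k, 0 <= d k) ->
  (\forall k \near \oo, forall t, 0 < t ->
    x <= (1 + t) * y k + (1 + t^-1) * d k /\
    y k <= (1 + t) * x + (1 + t^-1) * d k) ->
  d @ \oo --> 0 -> y @ \oo --> x.
Proof.
move=> x0 d0 xy d_cvg; apply/cvgrPdist_le => e e0.
pose t := e / (4 * (x + 1)).
have x1 : 0 < x + 1 by rewrite ltr_wpDl.
have t0 : 0 < t by rewrite divr_gt0// mulr_gt0.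
pose C := 2 * t + 1 + t^-1.
have ti0 : 0 < t^-1 by rewrite invr_gt0.
have C0 : 0 < C by rewrite /C; lra.
have tx : 2 * t * x <= e / 2.
  rewrite -subr_ge0 (_ : _ - _ = e / (2 * (x + 1))); last first.
    by rewrite /t; field; rewrite gt_eqF.
  by rewrite divr_ge0// ltW// mulr_gt0.
near=> k.
have xyk : forall s, 0 < s -> x <= (1 + s) * y k + (1 + s^-1) * d k /\
    y k <= (1 + s) * x + (1 + s^-1) * d k by near: k.
have Cd : C * d k <= e / 2.
  rewrite mulrC -ler_pdivlMr// -[d k]ger0_norm// -normrN -sub0r.
  by near: k; move/cvgrPdist_le: d_cvg; apply; rewrite !divr_gt0.
rewrite (splitr e); apply: le_trans (lerD tx Cd).
by apply: peter_paul_dist_le => // s s0; have [] := xyk s s0.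
Unshelve. all: by end_near. Qed.

Lemma peter_paul_cvge (R : realType) (x : \bar R) (y d : nat -> \bar R) :
  (0 <= x)%E -> (forall k, 0 <= y k)%E -> (forall k, 0 <= d k)%E ->
  (forall k (t : R), (0 < t)%R ->
    x <= (1 + t)%:E * y k + (1 + t^-1)%:E * d k)%E ->
  (forall k (t : R), (0 < t)%R ->
    y k <= (1 + t)%:E * x + (1 + t^-1)%:E * d k)%E ->
  d @ \oo --> 0%E -> y @ \oo --> x.
Proof.
move=> x0 y0 d0 xy yx /fine_cvgP[d_fin d_cvg].
have fin_of_le k (z z' : \bar R) : (0 <= z)%E -> d k \is a fin_num ->
    z' \is a fin_num -> (z <= (1 + 1)%:E * z' + (1 + 1^-1)%:E * d k)%E ->
    z \is a fin_num.
  move=> z0 dk z'_fin zz'; rewrite ge0_fin_numE// (le_lt_trans zz')//.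
  by rewrite ltey_eq fin_numD !fin_numM.
have [x_fin|x_inf] := boolP (x \is a fin_num); last first.
  apply: cvg_near_cst; near=> k.
  have infE (z : \bar R) : (0 <= z)%E -> z \isn't a fin_num -> z = +oo%E.
    by move=> z0; rewrite ge0_fin_numE// -leNgt leye_eq => /eqP.
  rewrite (infE x)// (infE (y k))//; apply: contra x_inf => y_fin.
  by apply: (fin_of_le k x (y k)) => //; [near: k|exact: xy].
have y_fin : \forall k \near \oo, y k \is a fin_num.
  apply: filterS d_fin => k dk; apply: (fin_of_le k (y k) x) => //.
  exact: yx.
rewrite -(fineK x_fin); apply/fine_cvgP; split=> //.
apply: (@peter_paul_cvgr _ _ _ (fine \o d)) => // [|k|]; try exact: fine_ge0.
near=> k => t t0; have := xy k t t0; have := yx k t t0.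
have [dk yk] : d k \is a fin_num /\ y k \is a fin_num by split; near: k.
by rewrite -(fineK x_fin) -(fineK dk) -(fineK yk) -!EFinM -!EFinD !lee_fin.
Unshelve. all: by end_near. Qed.

Section WeightedL2.
Context d (T : measurableType d) (R : realType).
Variable mu : {measure set T -> \bar R}.
Implicit Types w f g : T -> R.

Definition L2sq w f : \bar R := (\int[mu]_x (f x ^+ 2 * w x)%:E)%E.

Lemma measurable_sqr_weight w f : measurable_fun setT w ->
  measurable_fun setT f -> measurable_fun setT (fun x => (f x ^+ 2 * w x)%:E).
Proof.
move=> mw mf; apply/measurable_EFinP; apply: measurable_funM => //.
exact: measurable_funX.
Qed.

Lemma L2sq_ge0 w f : (forall x, 0 <= w x) -> (0 <= L2sq w f)%E.
Proof.
by move=> w0; apply: integral_ge0 => x _; rewrite lee_fin mulr_ge0// sqr_ge0.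
Qed.

Lemma sum_L2sqD (n : nat) w (F : 'I_n -> T -> R) f (K : R) : 0 <= K ->
  (forall x, 0 <= w x) -> measurable_fun setT w ->
  (forall i, measurable_fun setT (F i)) -> measurable_fun setT f ->
  (\sum_(i < n) L2sq w (F i) + K%:E * L2sq w f =
   \int[mu]_x (\sum_(i < n) F i x ^+ 2 * w x + K * (f x ^+ 2 * w x))%:E)%E.
Proof.
move=> K0 w0 mw mF mf.
have sqr_ge0w h x : (0 <= (h x ^+ 2 * w x)%:E)%E.
  by rewrite lee_fin mulr_ge0// sqr_ge0.
have mFw i := measurable_sqr_weight mw (mF i).
have mfw := measurable_sqr_weight mw mf.
rewrite -ge0_integral_sum// -ge0_integralZl_EFin//.
rewrite -ge0_integralD//; last 4 first.
- by move=> x _; apply: sume_ge0.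
- exact: emeasurable_sum.
- by move=> x _; rewrite mule_ge0.
- exact: measurable_funeM.
by apply: eq_integral => x _; rewrite EFinD -sumEFin EFinM.
Qed.

Lemma L2sqZ_weight (c : R) w f : 0 <= c -> (forall x, 0 <= w x) ->
  measurable_fun setT w -> measurable_fun setT f ->
  L2sq (fun x => c * w x) f = (c%:E * L2sq w f)%E.
Proof.
move=> c0 w0 mw mf; rewrite -ge0_integralZl_EFin//.
- by apply: eq_integral => x _; rewrite -EFinM mulrCA.
- by move=> x _; rewrite lee_fin mulr_ge0// sqr_ge0.
- exact: measurable_sqr_weight.
Qed.

Lemma le_L2sq_weight w w' f (C : R) : 0 <= C ->
  measurable_fun setT w -> measurable_fun setT w' -> measurable_fun setT f ->
  (forall x, 0 <= w x <= C * w' x) -> (forall x, 0 <= w' x) ->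
  (L2sq w f <= C%:E * L2sq w' f)%E.
Proof.
move=> C0 mw mw' mf ww' w'0; rewrite -L2sqZ_weight//.
apply: ge0_le_integral => //.
- by move=> x _; have /andP[? _] := ww' x; rewrite lee_fin mulr_ge0 ?sqr_ge0.
- exact: measurable_sqr_weight.
- by apply: measurable_sqr_weight => //; exact: measurable_funM.
- by move=> x _; have /andP[_ ?] := ww' x; rewrite lee_fin ler_wpM2l ?sqr_ge0.
Qed.

Lemma L2sq_peter_paul w f g (t : R) : 0 < t -> (forall x, 0 <= w x) ->
  measurable_fun setT w -> measurable_fun setT f -> measurable_fun setT g ->
  (L2sq w f <= (1 + t)%:E * L2sq w g +
               (1 + t^-1)%:E * L2sq w (fun x => g x - f x)%R)%E.
Proof.
move=> t0 w0 mw mf mg.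
have sqr_ge0w h x : (0 <= (h x ^+ 2 * w x)%:E)%E.
  by rewrite lee_fin mulr_ge0// sqr_ge0.
have c0 : 0 <= 1 + t by rewrite addr_ge0// ltW.
have c'0 : 0 <= 1 + t^-1 by rewrite addr_ge0// invr_ge0 ltW.
have mf2 := measurable_sqr_weight mw mf.
have mg2 := measurable_sqr_weight mw mg.
have mgf2 := measurable_sqr_weight mw (measurable_funB mg mf).
have gf_ge0 := sqr_ge0w (fun x => g x - f x).
rewrite -!ge0_integralZl_EFin// -ge0_integralD//; last 4 first.
- by move=> x _; rewrite mule_ge0.
- exact: measurable_funeM.
- by move=> x _; rewrite mule_ge0.
- exact: measurable_funeM.
apply: ge0_le_integral => //.
  by apply: emeasurable_funD; exact: measurable_funeM.
move=> x _; rewrite -!EFinM -EFinD lee_fin mulrA [X in _ + X]mulrA -mulrDl.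
by rewrite ler_wpM2r// peter_paul.
Qed.

Lemma cvg_L2sq w (u : nat -> T -> R) f : (forall x, 0 <= w x) ->
  measurable_fun setT w -> (forall k, measurable_fun setT (u k)) ->
  measurable_fun setT f ->
  (fun k => L2sq w (fun x => u k x - f x)) @ \oo --> 0%E ->
  (fun k => L2sq w (u k)) @ \oo --> L2sq w f.
Proof.
move=> w0 mw m_u mf.
apply: peter_paul_cvge => [|k|k|k t t0|k t t0]; try exact: L2sq_ge0.
  exact: L2sq_peter_paul.
rewrite (_ : L2sq w (fun x => u k x - f x) = L2sq w (fun x => f x - u k x)).
  exact: L2sq_peter_paul.
by apply: eq_integral => x _; rewrite -[u k x - f x]opprB sqrrN.
Qed.

Lemma L2sq_le_cvg_weight (w_ : nat -> T -> R) w f (C : \bar R) :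
  (forall k x, 0 <= w_ k x) -> (forall k, measurable_fun setT (w_ k)) ->
  measurable_fun setT f -> (forall x, w_ k x @[k --> \oo] --> w x) ->
  (forall k, L2sq (w_ k) f <= C)%E -> (L2sq w f <= C)%E.
Proof.
move=> w_0 mw_ mf w_w w_C.
have -> : L2sq w f =
    (\int[mu]_x limn_einf (fun k => (f x ^+ 2 * w_ k x)%:E))%E.
  apply: eq_integral => x _.
  have /cvg_limn_einf_sup[-> //] : (f x ^+ 2 * w_ k x)%:E @[k --> \oo] -->
    (f x ^+ 2 * w x)%:E.
  apply: cvg_EFin; first exact: nearW.
  by apply: cvgM; [exact: cvg_cst|exact: w_w].
apply: (@le_trans _ _ (limn_einf (fun k => L2sq (w_ k) f))).
  apply: fatou => // [k|k x _]; first exact: measurable_sqr_weight.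
  by rewrite lee_fin mulr_ge0 ?sqr_ge0.
rewrite limn_einf_lim; apply: lime_le; first exact: is_cvg_einfs.
apply: nearW => k; apply: le_trans (w_C k); apply: ereal_inf_lbound.
by exists k => /=.
Qed.

End WeightedL2.

(** * The Hardy inequality for smooth functions *)

Lemma le_integral_divergence (R : realType) N (G H : 'rV[R]_N -> R)
    (F dF : 'I_N -> 'rV[R]_N -> R) :
  continuous G -> compact_support G -> continuous H -> compact_support H ->
  C1_field F dF -> (forall i, compact_support (F i)) ->
  (forall x, G x <= H x + \sum_i dF i x) ->
  (\int[lebesgue_rV R N]_x (G x)%:E <= \int[lebesgue_rV R N]_x (H x)%:E)%E.
Proof.
move=> cG csG cH csH FdF csF GH.
have dFi i : (lebesgue_rV R N).-integrable setT (EFin \o dF i).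
  apply: integrable_continuous_compact_support; first by have [] := FdF i.
  exact: compact_support_C1_along (FdF i) (csF i).
have divFi : (lebesgue_rV R N).-integrable setT (fun x => \sum_i (dF i x)%:E)%E.
  by apply: integrable_sum => // i _; exact: dFi.
have Hi := integrable_continuous_compact_support cH csH.
rewrite -[leRHS]adde0.
have <- : (\int[lebesgue_rV R N]_x (\sum_i (dF i x)%:E) = 0)%E.
  rewrite integral_sum// big1// => i _.
  exact: integral_partial_eq0 (FdF i) (csF i).
rewrite -integralD//; apply: le_integral => //.
- exact: integrable_continuous_compact_support.
- exact: integrableD.
- by move=> x _; rewrite sumEFin -EFinD lee_fin; exact: GH.
Qed.

(* With W = beta X - V / 2, where V = - grad rho / rho, the last sum is the
   divergence of u^2 W rho for grad u = p; it completes the square of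
   p + u W. *)
Lemma hardy_divergence_ge (R : realFieldType) N (p V dV X dX : 'I_N -> R)
    (u rho K beta : R)
    (W := fun i => beta * X i + - (1/2) * V i)
    (dW := fun i => beta * dX i + - (1/2) * dV i) :
  0 <= rho -> 0 <= beta -> \sum_i dV i <= 2 * K ->
  2 * beta * \sum_i X i ^+ 2 <= \sum_i dX i ->
  u ^+ 2 * (beta ^+ 2 * (\sum_i X i ^+ 2) * rho) <=
  \sum_i p i ^+ 2 * rho + K * (u ^+ 2 * rho) +
  \sum_i ((p i * u + u * p i) * (W i * rho) +
          u * u * (dW i * rho + W i * (- V i * rho))).
Proof.
move=> rho_ge0 beta_ge0 dVK XdX.
have u2rho : 0 <= u ^+ 2 * rho by rewrite mulr_ge0 ?sqr_ge0.
rewrite addrAC -big_split/=.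
have square_ge i : u ^+ 2 * rho *
    (beta * dX i - beta ^+ 2 * X i ^+ 2 - 1/2 * dV i) <=
    p i ^+ 2 * rho + ((p i * u + u * p i) * (W i * rho) +
      u * u * (dW i * rho + W i * (- V i * rho))).
  rewrite -subr_ge0.
  have -> : p i ^+ 2 * rho + ((p i * u + u * p i) * (W i * rho) +
      u * u * (dW i * rho + W i * (- V i * rho))) -
      u ^+ 2 * rho * (beta * dX i - beta ^+ 2 * X i ^+ 2 - 1/2 * dV i) =
      rho * ((p i + u * W i) ^+ 2 + (u * V i / 2) ^+ 2).
    by rewrite /W /dW; field.
  by rewrite mulr_ge0// addr_ge0 ?sqr_ge0.
rewrite -lerBlDr; apply: le_trans (ler_sum _ (fun i _ => square_ge i)).
rewrite -mulr_sumr sumrB sumrB -!mulr_sumr.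
have := ler_wpM2l beta_ge0 XdX; move: dVK.
set S := \sum_i X i ^+ 2; set L := \sum_i dV i; set D := \sum_i dX i.
move=> LK SD; rewrite -subr_ge0.
have -> : u ^+ 2 * rho * (beta * D - beta ^+ 2 * S - 1/2 * L) -
    (u ^+ 2 * (beta ^+ 2 * S * rho) - K * (u ^+ 2 * rho)) =
    u ^+ 2 * rho * ((beta * D - beta * (2 * beta * S)) + (2 * K - L) / 2).
  by field.
by rewrite mulr_ge0// addr_ge0 ?subr_ge0// divr_ge0 ?subr_ge0.
Qed.

(* rho = exp (- U) with V = grad U and Laplacian of U at most L. *)
Definition potential_laplacian_le (R : realType) N (rho : 'rV[R]_N -> R)
    (L : R) : Prop :=
  [/\ forall x, 0 <= rho x, continuous rho &
    exists V dV : 'I_N -> 'rV[R]_N -> R,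
    [/\ C1_field (fun=> rho) (fun i x => - V i x * rho x), C1_field V dV &
        forall x, \sum_i dV i x <= L]].

Lemma hardy_C1_field (R : realType) N (rho u : 'rV[R]_N -> R)
    (X dX : 'I_N -> 'rV[R]_N -> R) (K beta : R) :
  0 <= K -> 0 <= beta -> potential_laplacian_le rho (2 * K) ->
  C1_field X dX ->
  (forall x, 2 * beta * \sum_i X i x ^+ 2 <= \sum_i dX i x) ->
  Ck 1 u -> compact_support u ->
  (L2sq (lebesgue_rV R N)
     (fun x => beta ^+ 2 * (\sum_i X i x ^+ 2) * rho x)%R u <=
   \sum_i L2sq (lebesgue_rV R N) rho (partial i u) +
   K%:E * L2sq (lebesgue_rV R N) rho u)%E.
Proof.
move=> K_ge0 beta_ge0 [rho_ge0 crho [V [dV [rhoV VdV dVK]]]] XdX X_div u_C1 csu.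
have udu i := C1_along_partial i u_C1.
have cu := Ck1_continuous u_C1.
have cp i : continuous (partial i u) by exact: u_C1.2.
have cX i : continuous (X i) by have [] := XdX i.
have cu2 : continuous (fun x => u x ^+ 2) by exact: continuous_funM.
have cp2rho i : continuous (fun x => partial i u x ^+ 2 * rho x).
  by apply: continuous_funM => //; exact: continuous_funM.
have mcont f : continuous f -> measurable_fun setT (f : 'rV[R]_N -> R).
  exact: continuous_measurable_rV.
rewrite sum_L2sqD//; try by [exact: mcont|move=> i; exact: mcont].
have W_C1 i := C1_alongD (C1_along_scale beta (XdX i))
  (C1_along_scale (- (1/2)) (VdV i)).
have flux_C1 i := C1_alongM (C1_alongM (udu i) (udu i))
  (C1_alongM (W_C1 i) (rhoV i)).
apply: (le_integral_divergence _ _ _ _ flux_C1) => [||||i|x].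
- apply: continuous_funM => //; apply: continuous_funM => //.
  apply: continuous_funM; first exact: cst_continuous.
  by apply: continuous_fun_sum => i; exact: continuous_funM.
- by apply: compact_supportW csu => x ->; rewrite expr0n mul0r.
- apply: continuous_funD; first exact: continuous_fun_sum.
  by apply: continuous_funM; [exact: cst_continuous|exact: continuous_funM].
- apply: compact_supportD.
    apply: compact_support_sum => i.
    apply: compact_supportW (compact_support_C1_along (udu i) csu) => x ->.
    by rewrite expr0n mul0r.
  by apply: compact_supportW csu => x ->; rewrite expr0n mul0r mulr0.
- by apply: compact_supportW csu => x ->; rewrite !mul0r.
- exact: hardy_divergence_ge.
Qed.

(** * The Hardy inequality in H^1 *)

Section RegularizedField.
Variables (R : realType) (N : nat).
Implicit Types (b x : 'rV[R]_N) (e q : R).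

(* With 0^-1 = 0 this tends to q^-1 as e tends to 0, also at q = 0. *)
Definition regularized_inv e q : R := q / (q + e) ^+ 2.

Lemma regularized_inv_ge0 e q : 0 <= q -> 0 <= regularized_inv e q.
Proof. by move=> q0; rewrite divr_ge0// sqr_ge0. Qed.

Lemma regularized_inv_le e q : 0 < e -> 0 <= q -> regularized_inv e q <= e^-1.
Proof.
move=> e0 q0; have qe0 : 0 < q + e by rewrite ltr_wpDl.
by rewrite ler_pdivrMr ?exprn_gt0// mulrC ler_pdivlMr//; nra.
Qed.

Lemma cvg_regularized_inv q : 0 <= q ->
  regularized_inv k.+1%:R^-1 q @[k --> \oo] --> q^-1.
Proof.
rewrite le_eqVlt => /orP[/eqP <-|q0].
  rewrite invr0; apply: cvg_near_cst; apply: nearW => k.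
  by rewrite /regularized_inv mul0r.
have -> : q^-1 = q / ((q + 0) * (q + 0)).
  by rewrite addr0; field; rewrite gt_eqF.
have qk : q + k.+1%:R^-1 @[k --> \oo] --> q + 0.
  by apply: cvgD; [exact: cvg_cst|exact: cvg_harmonic].
apply: cvgM; first exact: cvg_cst.
by apply: cvgV; [rewrite addr0 mulf_neq0// gt_eqF|exact: cvgM].
Qed.

Definition regularized_field b e (i : 'I_N) x : R :=
  (x - b) ord0 i / (sqnorm (x - b) + e).

Definition partial_regularized_field b e (i : 'I_N) x : R :=
  (sqnorm (x - b) + e)^-1 -
  2 * (x - b) ord0 i ^+ 2 / (sqnorm (x - b) + e) ^+ 2.

Let sqnormD_gt0 b e x : 0 < e -> 0 < sqnorm (x - b) + e.
Proof. by move=> e0; rewrite ltr_wpDl// sqnorm_ge0. Qed.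

Lemma C1_regularized_field b e : 0 < e ->
  C1_field (regularized_field b e) (partial_regularized_field b e).
Proof.
move=> e0 i.
have D0 x : sqnorm (x - b) + e != 0 by rewrite gt_eqF// sqnormD_gt0.
have dD := C1_alongD (C1_along_sqnormB b (delta_mx ord0 i : 'rV[R]_N))
  (C1_along_cst _ e).
have dX := C1_alongM (C1_along_coordB b _ i) (C1_alongV D0 dD).
apply: eq_C1_along dX => x //.
rewrite sum_delta_rV mxE !eqxx mul1r addr0 /partial_regularized_field.
by field; exact: D0.
Qed.

Lemma sum_sqr_regularized_field b e x :
  \sum_i regularized_field b e i x ^+ 2 = regularized_inv e (sqnorm (x - b)).
Proof.
rewrite /regularized_inv /sqnorm mulr_suml.
by apply: eq_bigr => i _; rewrite expr_div_n.
Qed.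

Lemma measurable_regularized_inv b e : 0 < e ->
  measurable_fun setT (fun x => regularized_inv e (sqnorm (x - b))).
Proof.
move=> e0; apply: continuous_measurable_rV.
under eq_fun do rewrite -sum_sqr_regularized_field.
apply: continuous_fun_sum => i; have [cX _ _] := C1_regularized_field b e0 i.
exact: continuous_funM.
Qed.

Lemma measurable_inv_sqnorm b :
  measurable_fun setT (fun x : 'rV[R]_N => (sqnorm (x - b))^-1).
Proof.
apply: (measurable_fun_cvg
  (fun k => @measurable_regularized_inv b k.+1%:R^-1 _)) => //.
by move=> x _; apply: cvg_regularized_inv; exact: sqnorm_ge0.
Qed.

Lemma regularized_field_div_ge b e x : 0 < e ->
  2 * ((N%:R - 2) / 2) * \sum_i regularized_field b e i x ^+ 2 <=
  \sum_i partial_regularized_field b e i x.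
Proof.
move=> e0; have De := sqnormD_gt0 b x e0.
rewrite sum_sqr_regularized_field /regularized_inv sumrB sumr_const card_ord.
rewrite -mulr_suml -mulr_sumr -/(sqnorm (x - b)) -[_^-1 *+ N]mulr_natr.
set q := sqnorm _ in De *; rewrite -subr_ge0.
have -> : (q + e)^-1 * N%:R - 2 * q / (q + e) ^+ 2 -
    2 * ((N%:R - 2) / 2) * (q / (q + e) ^+ 2) = N%:R * e / (q + e) ^+ 2.
  by field; rewrite gt_eqF.
by rewrite divr_ge0 ?sqr_ge0// mulr_ge0// ltW.
Qed.

End RegularizedField.

(* The pairs (phi, g) in the closure of the graph of the gradient. *)
Definition weighted_H1 (R : realType) N (rho phi : 'rV[R]_N -> R)
    (g : 'I_N -> 'rV[R]_N -> R) : Prop :=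
  [/\ measurable_fun setT phi, forall i, measurable_fun setT (g i) &
    exists u : nat -> 'rV[R]_N -> R,
    [/\ forall k, Ck 1 (u k), forall k, compact_support (u k),
      (fun k => L2sq (lebesgue_rV R N) rho (fun x => u k x - phi x))
        @ \oo --> 0%E &
      forall i, (fun k => L2sq (lebesgue_rV R N) rho
        (fun x => partial i (u k) x - g i x)) @ \oo --> 0%E]].

Section HardyH1.
Variables (R : realType) (N : nat).
Local Notation L2sq := (L2sq (lebesgue_rV R N)).
Local Notation beta := ((N%:R - 2) / 2 : R).
Variables (rho phi : 'rV[R]_N -> R) (g : 'I_N -> 'rV[R]_N -> R) (K : R).
Hypothesis N_ge2 : (2 <= N)%N.
Hypothesis K_ge0 : 0 <= K.
Hypothesis rho_weight : potential_laplacian_le rho (2 * K).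
Hypothesis phi_H1 : weighted_H1 rho phi g.

Let rho_ge0 x : 0 <= rho x. Proof. by have [+ _ _] := rho_weight; exact. Qed.

Let mrho : measurable_fun setT rho.
Proof. by have [_ crho _] := rho_weight; exact: continuous_measurable_rV. Qed.

Let mphi : measurable_fun setT phi. Proof. by have [] := phi_H1. Qed.

Let energy := (\sum_i L2sq rho (g i) + K%:E * L2sq rho phi)%E.

Let energy_ge0 : (0 <= energy)%E.
Proof.
rewrite adde_ge0 ?mule_ge0 ?lee_fin ?L2sq_ge0// sume_ge0// => i _.
exact: L2sq_ge0.
Qed.

Let hardy_weight b e x :=
  beta ^+ 2 * regularized_inv e (sqnorm (x - b)) * rho x.

Let hardy_weight_ge0 b e x : 0 <= hardy_weight b e x.
Proof.
by rewrite mulr_ge0// mulr_ge0 ?sqr_ge0// regularized_inv_ge0// sqnorm_ge0.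
Qed.

Let measurable_hardy_weight b e : 0 < e ->
  measurable_fun setT (hardy_weight b e).
Proof.
move=> e0; apply: measurable_funM => //; apply: measurable_funM => //.
exact: measurable_regularized_inv.
Qed.

Lemma cvg_L2sq_hardy_weight (u : nat -> 'rV[R]_N -> R) b e : 0 < e ->
  (forall k, measurable_fun setT (u k)) ->
  (fun k => L2sq rho (fun x => u k x - phi x)) @ \oo --> 0%E ->
  (fun k => L2sq (hardy_weight b e) (u k)) @ \oo -->
    L2sq (hardy_weight b e) phi.
Proof.
move=> e0 m_u u_phi; have mw := measurable_hardy_weight b e0.
have C0 : 0 <= beta ^+ 2 / e by rewrite divr_ge0 ?sqr_ge0// ltW.
apply: cvg_L2sq => //; apply: (@squeeze_cvge _ _ _ _ (fun=> 0%E) _ (fun k =>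
  (beta ^+ 2 / e)%:E * L2sq rho (fun x => u k x - phi x)%R)%E).
- apply: nearW => k; rewrite L2sq_ge0//=; apply: le_L2sq_weight => //.
    exact: measurable_funB.
  move=> x; rewrite hardy_weight_ge0 ler_wpM2r// ler_wpM2l ?sqr_ge0//.
  by rewrite regularized_inv_le// sqnorm_ge0.
- exact: cvg_cst.
- by rewrite -(mule0 (beta ^+ 2 / e)%:E); exact: cvgeZl.
Qed.

Lemma hardy_regularized b e : 0 < e ->
  (L2sq (hardy_weight b e) phi <= energy)%E.
Proof.
move=> e0; have [_ mg [u [u_C1 csu u_phi du_g]]] := phi_H1.
have m_u k : measurable_fun setT (u k).
  by apply: continuous_measurable_rV; exact: Ck1_continuous.
have mdu k i : measurable_fun setT (partial i (u k)).
  by apply: continuous_measurable_rV; exact: (u_C1 k).2.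
apply: (lee_cvg_to (a := \oo) (f := fun k => L2sq (hardy_weight b e) (u k))
  (g := fun k => \sum_i L2sq rho (partial i (u k)) + K%:E * L2sq rho (u k))%E).
- exact: cvg_L2sq_hardy_weight.
- apply: cvgeD; last by apply: cvgeZl => //; exact: cvg_L2sq.
    apply: ge0_adde_def; rewrite inE.
      by apply: sume_ge0 => i _; exact: L2sq_ge0.
    by rewrite mule_ge0 ?lee_fin ?L2sq_ge0.
  apply: cvg_nnesum => [i _|i _]; first by apply: nearW => k; exact: L2sq_ge0.
  exact: cvg_L2sq.
- apply: nearW => k; rewrite (_ : hardy_weight b e = fun x =>
    beta ^+ 2 * (\sum_i regularized_field b e i x ^+ 2) * rho x); last first.
    by apply/funext => x; rewrite sum_sqr_regularized_field.
  apply: hardy_C1_field (C1_regularized_field b e0) _ (u_C1 k) (csu k) => //.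
    by rewrite divr_ge0// subr_ge0 ler_nat.
  by move=> x; exact: regularized_field_div_ge.
Qed.

Lemma hardy_pole b :
  (L2sq (fun x => beta ^+ 2 / sqnorm (x - b) * rho x)%R phi <= energy)%E.
Proof.
apply: (L2sq_le_cvg_weight (w_ := fun k => hardy_weight b k.+1%:R^-1)) => //.
- by move=> k; apply: measurable_hardy_weight.
- move=> x; apply: cvgM; last exact: cvg_cst.
  apply: cvgM; first exact: cvg_cst.
  by apply: cvg_regularized_inv; exact: sqnorm_ge0.
- by move=> k; apply: hardy_regularized.
Qed.

Lemma hardy_multipole n (a : 'I_n -> 'rV[R]_N) : (0 < n)%N ->
  ((beta ^+ 2 / n%:R)%:E *
     \sum_(i < n) L2sq (fun x => (sqnorm (x - a i))^-1 * rho x)%R phi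
   <= energy)%E.
Proof.
move=> n0; have n_neq0 : n%:R != 0 :> R by rewrite pnatr_eq0 -lt0n.
have w_ge0 i x : 0 <= (sqnorm (x - a i))^-1 * rho x.
  by rewrite mulr_ge0// invr_ge0 sqnorm_ge0.
have mw i :
    measurable_fun setT (fun x : 'rV[R]_N => (sqnorm (x - a i))^-1 * rho x).
  by apply: measurable_funM => //; exact: measurable_inv_sqnorm.
rewrite ge0_sume_distrr; last by move=> i _; exact: L2sq_ge0.
apply: (@le_trans _ _ (\sum_(i < n) (n%:R^-1)%:E * energy)%E); last first.
  rewrite -ge0_sume_distrl//.
  by rewrite sumEFin sumr_const card_ord -[_^-1 *+ n]mulr_natr mulVf ?mul1e.
apply: lee_sum => i _; rewrite [_ / _]mulrC EFinM -muleA.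
apply: lee_wpmul2l; first by rewrite lee_fin invr_ge0.
apply: le_trans (hardy_pole (a i)); rewrite -L2sqZ_weight ?sqr_ge0//.
rewrite (_ : (fun x => beta ^+ 2 / _ * rho x) =
  fun x => beta ^+ 2 * ((sqnorm (x - a i))^-1 * rho x))//.
by apply/funext => x; rewrite mulrA.
Qed.

End HardyH1.

(** * The Gaussian weight *)

Section Gaussian.
Variables (R : realType) (N n : nat) (A : 'M[R]_N) (a : 'I_n -> 'rV[R]_N).
Implicit Types (v x : 'rV[R]_N) (i j : 'I_N).

Lemma trace_pos_def_sym_ge0 : pos_def_sym A -> 0 <= \tr A.
Proof.
move=> [_ Apos]; apply: sumr_ge0 => i _.
have /ltW : 0 < qform A (delta_mx ord0 i).
  by apply: Apos; apply/rV0Pn; exists i; rewrite mxE !eqxx oner_neq0.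
by rewrite /qform -rowE trmx_delta -colE !mxE.
Qed.

Lemma mu_dens_ge0 x : 0 <= mu_dens A a x.
Proof.
apply: divr_ge0; first exact: expR_ge0.
by apply/fine_ge0/intRN_ge0 => y; rewrite lee_fin expR_ge0.
Qed.

Definition grad_potential i x : R := \sum_(k < n) ((x - a k) *m A) ord0 i.

Lemma C1_grad_potential : C1_field grad_potential (fun i _ => n%:R * A i i).
Proof.
move=> i; apply: eq_C1_along (C1_along_sum _ (fun k =>
  C1_along_mulmxB A (a k) (delta_mx ord0 i) i)) => x //.
by rewrite -rowE mxE sumr_const card_ord mulr_natl.
Qed.

Hypothesis Asym : A^T = A.

Lemma C1_along_mu_dens v : C1_along v (mu_dens A a)
  (fun x => - (\sum_j v ord0 j * grad_potential j x) * mu_dens A a x).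
Proof.
pose c : R := (fine (intRN (fun y => (gauss_unnorm A a y)%:E)))^-1.
apply: eq_C1_along (C1_along_scale c (C1_along_expR (C1_along_scale (- (1/2))
  (C1_along_sum _ (fun k => C1_along_qformB (a k) v Asym))))) => x.
  by rewrite mulrC.
rewrite /mu_dens -/c /gauss_unnorm /grad_potential.
under [in RHS]eq_bigr do rewrite mulr_sumr.
by rewrite exchange_big/= -mulr_sumr; field.
Qed.

Lemma mu_dens_potential_laplacian_le :
  potential_laplacian_le (mu_dens A a) (2 * (n%:R / 2 * \tr A)).
Proof.
split; first exact: mu_dens_ge0.
  by have [] := C1_along_mu_dens 0.
exists grad_potential, (fun i _ => n%:R * A i i).
split=> [i||_]; [|exact: C1_grad_potential|].
  by apply: eq_C1_along (C1_along_mu_dens _) => x //; rewrite sum_delta_rV.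
by rewrite -mulr_sumr [leRHS](_ : _ = n%:R * \tr A)//; field.
Qed.

End Gaussian.

Section IntRNSquares.
Variables (R : realType) (N : nat).
Local Notation L2sq := (L2sq (lebesgue_rV R N)).

Lemma intRN_sum_sqr m (w f : 'I_m -> 'rV[R]_N -> R) :
  (forall i x, 0 <= w i x) -> (forall i, measurable_fun setT (w i)) ->
  (forall i, measurable_fun setT (f i)) ->
  intRN (fun x => (\sum_i f i x ^+ 2 * w i x)%:E) =
  (\sum_i L2sq (w i) (f i))%E.
Proof.
move=> w_ge0 mw mf.
have fw_ge0 i x : (0 <= (f i x ^+ 2 * w i x)%:E)%E.
  by rewrite lee_fin mulr_ge0 ?sqr_ge0.
have mfw i := measurable_sqr_weight (mw i) (mf i).
under eq_fun do rewrite -sumEFin.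
rewrite intRN_lebesgue ?ge0_integral_sum//; first exact: emeasurable_sum.
by move=> x; apply: sume_ge0 => i _; exact: fw_ge0.
Qed.

Lemma intRN_sqr (w f : 'rV[R]_N -> R) : (forall x, 0 <= w x) ->
  measurable_fun setT w -> measurable_fun setT f ->
  intRN (fun x => (f x ^+ 2 * w x)%:E) = L2sq w f.
Proof.
move=> w0 mw mf; apply: intRN_lebesgue; first exact: measurable_sqr_weight.
by move=> x; rewrite lee_fin mulr_ge0// sqr_ge0.
Qed.

Lemma intRN_sqnorm (w : 'rV[R]_N -> R) (G : 'rV[R]_N -> 'rV[R]_N) :
  (forall x, 0 <= w x) -> measurable_fun setT w ->
  (forall j, measurable_fun setT (fun x => G x ord0 j)) ->
  intRN (fun x => (sqnorm (G x) * w x)%:E) =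
  (\sum_j L2sq w (fun x => G x ord0 j))%E.
Proof.
move=> w0 mw mG; rewrite -(intRN_sum_sqr (w := fun=> w))//; congr intRN.
by apply/funext => x; rewrite mulr_suml.
Qed.

Lemma intRN_sum_div (w f : 'rV[R]_N -> R) n (q : 'I_n -> 'rV[R]_N -> R) :
  (forall x, 0 <= w x) -> measurable_fun setT w -> measurable_fun setT f ->
  (forall i x, 0 <= q i x) ->
  (forall i, measurable_fun setT (fun x => (q i x)^-1)) ->
  intRN (fun x => ((\sum_i f x ^+ 2 / q i x) * w x)%:E) =
  (\sum_i L2sq (fun x => (q i x)^-1 * w x)%R f)%E.
Proof.
move=> w0 mw mf q0 mq; rewrite -(intRN_sum_sqr (f := fun=> f))//.
- congr intRN; apply/funext => x; rewrite mulr_suml.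
  by under eq_bigr do rewrite -mulrA.
- by move=> i x; rewrite mulr_ge0// invr_ge0.
- by move=> i; exact: measurable_funM.
Qed.

Lemma cvg0_L2sq_coord (w : 'rV[R]_N -> R) (G : nat -> 'rV[R]_N -> 'rV[R]_N) j :
  (forall x, 0 <= w x) -> measurable_fun setT w ->
  (forall k i, measurable_fun setT (fun x => G k x ord0 i)) ->
  (fun k => intRN (fun x => (sqnorm (G k x) * w x)%:E)) @ \oo --> 0%E ->
  (fun k => L2sq w (fun x => G k x ord0 j)) @ \oo --> 0%E.
Proof.
move=> w0 mw mG; apply: (squeeze_cvge _ (cvg_cst 0%E)); apply: nearW => k /=.
rewrite L2sq_ge0//= intRN_sqnorm// (bigD1 j)//= leeDl// sume_ge0// => i _.
exact: L2sq_ge0.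
Qed.

End IntRNSquares.

Lemma H1mu_weighted_H1 (R : realType) N n (A : 'M[R]_N) (a : 'I_n -> 'rV[R]_N)
    (phi : 'rV[R]_N -> R) (g : 'rV[R]_N -> 'rV[R]_N) :
  A^T = A -> H1mu_with_grad A a phi g ->
  weighted_H1 (mu_dens A a) phi (fun i x => g x ord0 i).
Proof.
move=> Asym [/borel_fun_measurable mphi [bg [u [u_smooth [u_phi du_g]]]]].
have mg j := borel_fun_measurable (bg j).
have [mu_ge0 mu_cont _] := mu_dens_potential_laplacian_le a Asym.
have mmu := continuous_measurable_rV mu_cont.
have u_C1 k : Ck 1 (u k) := (u_smooth k).1 1%N.
split=> //; exists u; split=> // [k||j]; first exact: (u_smooth k).2.
- apply: cvg_trans u_phi; apply: near_eq_cvg; apply: nearW => k.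
  rewrite intRN_sqr//; apply: measurable_funB => //.
  by apply: continuous_measurable_rV; exact: ((u_smooth k).1 0%N).
- have coordE k i : (fun x => (grad (u k) x - g x) ord0 i) =
      fun x => partial i (u k) x - g x ord0 i.
    by apply/funext => x; rewrite !mxE.
  under eq_fun do rewrite -coordE.
  apply: cvg0_L2sq_coord du_g => // k i; rewrite coordE.
  apply: measurable_funB => //; apply: continuous_measurable_rV.
  exact: (u_C1 k).2.
Qed.

Theorem theorem3p2 (R : realType) (N n : nat) (a : 'I_n -> 'rV[R]_N)
    (A : 'M[R]_N) (phi : 'rV[R]_N -> R) (g : 'rV[R]_N -> 'rV[R]_N) :
  (3 <= N)%N -> (1 <= n)%N -> pos_def_sym A ->
  H1mu_with_grad A a phi g ->
  ((((N%:R - 2) / 2) ^+ 2 / n%:R)%:E *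
     intRN (fun x => ((\sum_(i < n) phi x ^+ 2 / sqnorm (x - a i)) * mu_dens A a x)%:E)
   <= intRN (fun x => (sqnorm (g x) * mu_dens A a x)%:E)
      + (n%:R / 2 * \tr A)%:E * intRN (fun x => (phi x ^+ 2 * mu_dens A a x)%:E))%E.
Proof.
move=> N3 n1 Apos phi_H1mu; have Asym := Apos.1.
have mu_potential := mu_dens_potential_laplacian_le a Asym.
have phi_H1 := H1mu_weighted_H1 Asym phi_H1mu.
have [mu_ge0 /continuous_measurable_rV mmu _] := mu_potential.
have [mphi mg _] := phi_H1.
rewrite intRN_sqr// intRN_sqnorm// intRN_sum_div//.
- apply: (hardy_multipole (ltnW N3) _ mu_potential phi_H1 a n1).
  by rewrite mulr_ge0 ?divr_ge0// trace_pos_def_sym_ge0.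
- by move=> i x; exact: sqnorm_ge0.
- by move=> i; exact: measurable_inv_sqnorm.
Qed.
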